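(* Let $F_1(n)$ denote the number of partitions of $n$ into parts $\equiv\pm1,\pm19,\pm36$ or $\pm38\pmod{76}$ such that the parts $\equiv\pm1$ and $\pm19\pmod{76}$ have $2$ colors. Let $F_2(n)$ denote the number of partitions of $n$ into parts $\equiv\pm19,\pm36,\pm37$ or $\pm38\pmod{76}$ such that the parts $\equiv\pm19$ and $\pm37\pmod{76}$ have $2$ colors. Let $F_3(n)$ denote the number of partitions of $n$ into parts $\equiv\pm1,\pm18,\pm20$ and $\pm37\pmod{76}$ such that the parts $\equiv\pm1$ and $\pm37\pmod{76}$ have $2$ colors. Here $+38$ and $-38$ are counted as two separate residues (although they coincide modulo $76$), so that parts $\equiv38\pmod{76}$ occur in $2$ colors in total in $F_1$ and in $F_2$. Then for every integer $n\ge18$, $$F_1(n)+F_2(n-18)=F_3(n).$$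
   Context: A part in a partition has $r$ colors if there are $r$ copies of each such part, all viewed as distinct objects; parts for which no number of colors is specified have one color. Partitions are unordered, and each of the counting functions equals $1$ at $n=0$. With $(\lambda;q)_\infty=\prod_{j\ge0}(1-\lambda q^j)$, $(\lambda_1,\dots,\lambda_s;q)_\infty=\prod_{j}(\lambda_j;q)_\infty$ and the convention $(q^{r\pm};q^t)_\infty:=(q^r,q^{t-r};q^t)_\infty$ for $0<r<t$ (so $(q^{38\pm};q^{76})_\infty=(q^{38};q^{76})_\infty^2$), and $(q^{r_1\pm},\dots,q^{r_s\pm};q^t)_\infty:=\prod_j (q^{r_j\pm};q^t)_\infty$, the generating functions are $$\sum_{n\ge0}F_1(n)q^n=\frac{1}{(q^{36\pm},q^{38\pm};q^{76})_\infty(q^{1\pm},q^{19\pm};q^{76})_\infty^2},$$ $$\sum_{n\ge0}F_2(n)q^n=\frac{1}{(q^{36\pm},q^{38\pm};q^{76})_\infty(q^{19\pm},q^{37\pm};q^{76})_\infty^2},$$ $$\sum_{n\ge0}F_3(n)q^n=\frac{1}{(q^{18\pm},q^{20\pm};q^{76})_\infty(q^{1\pm},q^{37\pm};q^{76})_\infty^2}.$$ *)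

(* Defs.v *)
From mathcomp Require Import all_boot.

Set Implicit Arguments.
Unset Strict Implicit.
Unset Printing Implicit Defensive.

(* Number of signed residues +r, -r modulo t to which m is congruent. It is 2
   when r and -r coincide modulo t and m belongs to that class, matching the
   double factor in (q^{38±}; q^76) = (q^38; q^76)^2. *)
Definition pm (r t m : nat) : nat :=
  (m == r %[mod t]) + (m + r == 0 %[mod t]).

(* Here c m is the number of colors of the part m, and m is not allowed as a
   part when c m = 0. A colored part of size at most n is a pair of i < n,
   standing for the size i.+1, and of a color of that size. *)
Definition colored_part (c : nat -> nat) (n : nat) : finType :=
  {i : 'I_n & 'I_(c i.+1)}.

Definition part_size (c : nat -> nat) (n : nat) (p : colored_part c n) : nat :=
  (tag p).+1.

(* A partition is given by the multiplicities of its colored parts. In a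
   partition of n all parts and all multiplicities are at most n, so these
   bounds exclude nothing. *)
Definition colored_partitions (c : nat -> nat) (n : nat) :
    {set {ffun colored_part c n -> 'I_n.+1}} :=
  [set f : {ffun colored_part c n -> 'I_n.+1} |
     \sum_(p : colored_part c n) f p * part_size p == n].

Definition num_colored_partitions (c : nat -> nat) (n : nat) : nat :=
  #|colored_partitions c n|.

Definition colors1 (m : nat) : nat :=
  2 * pm 1 76 m + 2 * pm 19 76 m + pm 36 76 m + pm 38 76 m.

Definition colors2 (m : nat) : nat :=
  2 * pm 19 76 m + pm 36 76 m + 2 * pm 37 76 m + pm 38 76 m.

Definition colors3 (m : nat) : nat :=
  2 * pm 1 76 m + pm 18 76 m + pm 20 76 m + 2 * pm 37 76 m.

Definition F1 (n : nat) : nat := num_colored_partitions colors1 n.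
Definition F2 (n : nat) : nat := num_colored_partitions colors2 n.
Definition F3 (n : nat) : nat := num_colored_partitions colors3 n.

(* Main.v *)
(* Write [r] for (q^r, q^(76-r); q^76)_oo. Clearing denominators turns the
   identity of generating functions into
     q^18 [20][18][1]^2 + [37]^2 [20][18] = [38][36][19]^2,
   the three-term theta relation for (a, b, c, d) = (37, 19, 1, 0). By the
   Jacobi triple product, multiplying [r] by (q^76; q^76)_oo gives a theta
   series. In a product of two of them, sorting the index pairs (i, j) by the
   parity of i + j yields theta series P and Q with
     [a+b][a-b] (q^76; q^76)_oo^2 = Q(a) P(b) - q^(a-b) P(a) Q(b),
   which makes the three-term relation a Pluecker relation. Power series are
   computed modulo q^N, that is in a commutative ring where q is nilpotent. *)
Require Import Defs.
From mathcomp Require Import all_boot all_order all_algebra.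
From mathcomp Require Import zify ring.

Section ThetaProducts.

Set Implicit Arguments.
Unset Strict Implicit.
Unset Printing Implicit Defensive.

Import GRing.Theory Num.Theory.
Local Open Scope ring_scope.

(** * Sums over finite windows of integers *)

(** Serves to re-index truncated double sums: the surplus indices on either side carry zero terms,
    so the two index sets need not match exactly. *)
Lemma eq_big_seq_supp (V : nmodType) (I : eqType) (s t : seq I) (F : I -> V) :
    uniq s -> uniq t -> (forall i, F i != 0 -> (i \in s) && (i \in t)) ->
  \sum_(i <- s) F i = \sum_(i <- t) F i.
Proof.
move=> us ut supp.
have nz r : \sum_(i <- r) F i = \sum_(i <- [seq i <- r | F i != 0]) F i.
  rewrite big_filter [RHS]big_mkcond /=; apply: eq_bigr => i _.
  by case: eqP.
rewrite nz [RHS]nz; apply/perm_big/uniq_perm; rewrite ?filter_uniq // => i.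
by rewrite !mem_filter; case: eqP => //= /eqP/supp/andP[-> ->].
Qed.

Definition zrange (M : nat) : seq int :=
  [seq k%:Z - M%:Z | k <- iota 0 (M + M).+1].

Lemma mem_zrange M z : (z \in zrange M) = (`|z| <= M)%N.
Proof.
apply/mapP/idP => [[k]|zM].
  rewrite mem_iota => /andP[_ kM] ->; lia.
exists (absz (z + M%:Z)); first by rewrite mem_iota; lia.
lia.
Qed.

Lemma zrange_uniq M : uniq (zrange M).
Proof. by rewrite map_inj_uniq ?iota_uniq // => i j; lia. Qed.

(** * Units and nilpotents in commutative rings *)

Definition has_inv (R : comNzRingType) (u : R) := exists v, u * v = 1.

Lemma has_invM (R : comNzRingType) (u v : R) :
  has_inv u -> has_inv v -> has_inv (u * v).
Proof.
by move=> [a ua] [b vb]; exists (a * b); rewrite mulrACA ua vb mulr1.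
Qed.

Lemma has_inv_prod (R : comNzRingType) (I : Type) (r : seq I) (F : I -> R) :
  (forall i, has_inv (F i)) -> has_inv (\prod_(i <- r) F i).
Proof.
by move=> Fi; apply: big_ind => //; [exists 1; rewrite mulr1 | exact: has_invM].
Qed.

Lemma has_invX (R : comNzRingType) (u : R) n : has_inv u -> has_inv (u ^+ n).
Proof.
by move=> [v uv]; exists (v ^+ n); rewrite -exprMn uv expr1n.
Qed.

Lemma has_invI (R : comNzRingType) (u : R) : has_inv u -> injective ( *%R u).
Proof.
by move=> [v uv] a b /(congr1 ( *%R v)); rewrite !mulrA ![v * u]mulrC uv !mul1r.
Qed.

Lemma nilp_has_inv (R : comNzRingType) (x : R) N :
  x ^+ N = 0 -> has_inv (1 - x).
Proof.
move=> xN; exists (\sum_(i < N) x ^+ i).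
by rewrite -opprB mulNr -subrX1 xN sub0r opprK.
Qed.

Lemma nilp_exprn (R : comNzRingType) (x : R) N e :
  x ^+ N = 0 -> (N <= e)%N -> x ^+ e = 0.
Proof. by move=> xN /subnKC <-; rewrite exprD xN mul0r. Qed.

Lemma nilp_has_invX (R : comNzRingType) (x : R) N e :
  x ^+ N = 0 -> (0 < e)%N -> has_inv (1 - x ^+ e).
Proof.
move=> xN e0; apply: (@nilp_has_inv _ _ N); rewrite -exprM.
by apply: nilp_exprn xN _; rewrite leq_pmull.
Qed.

(** * Gaussian binomial coefficients *)

Definition qfact (R : comNzRingType) (q : R) n := \prod_(i < n) (1 - q ^+ i.+1).

(** The Gaussian binomial, given by its Pascal recurrence so that it makes sense in every
    commutative ring, without division. *)
Fixpoint qbin (R : comNzRingType) (q : R) (n k : nat) : R :=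
  match n, k with
  | _, 0 => 1
  | 0, _.+1 => 0
  | n'.+1, k'.+1 => qbin q n' k' + q ^+ k * qbin q n' k
  end.

Lemma qbin_small (R : comNzRingType) (q : R) n k :
  (n < k)%N -> qbin q n k = 0.
Proof.
elim: n k => [|n IH] [|k] //= nk.
by rewrite !IH // ?mulr0 ?addr0 // ltnW.
Qed.

Lemma qbin0 (R : comNzRingType) (q : R) n : qbin q n 0 = 1.
Proof. by case: n. Qed.

Lemma qbinn (R : comNzRingType) (q : R) n : qbin q n n = 1.
Proof. by elim: n => //= n ->; rewrite qbin_small // mulr0 addr0. Qed.

(** Induction on k + l; the two Pascal terms combine through (1 - q^k) + q^k (1 - q^l) = 1 -
    q^(k+l). *)
Lemma qbin_qfact (R : comNzRingType) (q : R) k l :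
  qbin q (k + l) k * qfact q k * qfact q l = qfact q (k + l).
Proof.
have E n : qfact q n.+1 = qfact q n * (1 - q ^+ n.+1).
  by rewrite /qfact big_ord_recr.
have [n] : exists n, (k + l)%N = n by exists (k + l)%N.
elim: n k l => [|n IH] [|k] [|l] // kl.
- by rewrite /qfact !big_ord0 /= !mulr1.
- by rewrite /qfact big_ord0 add0n /= !mul1r.
- by rewrite addn0 qbinn mul1r /qfact big_ord0 mulr1.
have H1 := IH k l.+1 ltac:(lia); have H2 := IH k.+1 l ltac:(lia).
have En : (k + l.+1 = n)%N by lia.
have -> : (k.+1 + l.+1 = n.+1)%N by lia.
rewrite En in H1; rewrite addSnnS En in H2.
have -> : qbin q n.+1 k.+1 * qfact q k.+1 * qfact q l.+1 =
    qbin q n k * qfact q k * qfact q l.+1 * (1 - q ^+ k.+1) +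
    q ^+ k.+1 * (qbin q n k.+1 * qfact q k.+1 * qfact q l) * (1 - q ^+ l.+1).
  by rewrite /= !E; ring.
rewrite H1 H2 E; have -> : q ^+ n.+1 = q ^+ k.+1 * q ^+ l.+1.
  by rewrite -exprD; congr (_ ^+ _); lia.
ring.
Qed.

(** Peel off the factor i = 0 and apply the induction hypothesis to z q; comparing powers of z gives
    the recurrence of [qbin]. Keeping u in place of 1 avoids negative exponents in the triple
    product. *)
Lemma qbinomial_theorem (R : comNzRingType) (q u z : R) n :
  \prod_(i < n) (u - z * q ^+ i) =
  \sum_(k < n.+1)
    qbin q n k * (-1) ^+ k * q ^+ 'C(k, 2) * z ^+ k * u ^+ (n - k).
Proof.
elim: n z => [|n IH] z.
  by rewrite big_ord0 big_ord1 /= !expr0 !mulr1.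
rewrite big_ord_recl expr0 mulr1.
under eq_bigr => i _ do rewrite exprS mulrA.
rewrite IH mulrBl !mulr_sumr [RHS]big_ord_recl /=.
rewrite big_ord_recl [X in _ - X]big_ord_recr /=.
rewrite [X in _ = _ + X]big_ord_recr /= (qbin_small q (ltnSn n)) qbinn.
rewrite opprD !addrA; congr (_ + _); last first.
  rewrite /bump /= !add1n binS bin1 !subnn exprD !exprMn !exprS !expr0; ring.
rewrite -addrA -sumrB subn0; congr (_ + _).
  by rewrite bin0n qbin0 !expr0 exprS; ring.
apply: eq_bigr => i _; rewrite /bump /= add0n !add1n subSS binS bin1.
have -> : (n - i = (n - i.+1).+1)%N by have := ltn_ord i; lia.
rewrite exprD !exprMn !exprS; ring.
Qed.

(** * The Jacobi triple product, finite and truncated *)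

(** The theta exponent for modulus 2m and residue a. [absz] only casts to [nat]: for a <= 2m the
    value is nonnegative. *)
Definition texp (m a : nat) (j : int) : nat :=
  absz (m%:Z * (j * (j - 1)) + a%:Z * j).

Lemma texpE m a j : (a <= m + m)%N ->
  (texp m a j)%:Z = m%:Z * (j * (j - 1)) + a%:Z * j.
Proof.
move=> am; rewrite /texp gez0_abs //.
case: j => [[|j]|j]; [lia | nia |].
have -> : m%:Z * (Negz j * (Negz j - 1)) + a%:Z * Negz j =
    j.+1%:Z * (m%:Z * j%:Z + (m + m - a)%N%:Z).
  by rewrite NegzE -subzn ?PoszD ?intS; [ring | lia].
by rewrite mulr_ge0 ?addr_ge0 ?mulr_ge0.
Qed.

(** This growth makes every theta term with |j| >= N vanish once x^N = 0. *)
Lemma texp_ge m a j : (0 < a < m + m)%N -> (absz j <= texp m a j)%N.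
Proof.
move=> /andP[a0 am]; rewrite -lez_nat texpE ?(ltnW am) //.
case: j => [[|j]|j]; [lia | nia |].
have -> : m%:Z * (Negz j * (Negz j - 1)) + a%:Z * Negz j =
    j.+1%:Z * (m%:Z * j%:Z + (m + m - a)%N%:Z).
  by rewrite NegzE -subzn ?PoszD ?intS; [ring | lia].
have : (0 < m + m - a)%N by rewrite subn_gt0.
nia.
Qed.

(* The q-binomial theorem with [q = X^t], [u = q^K], [z = X^a] and [2K] factors;
   pulling the powers of [X] out of the first [K] factors leaves the common
   monomial [X^e0], which is cancelled in the domain {poly int}. *)
Lemma finite_jtp m a K : (a <= m + m)%N ->
  \prod_(i < K) ((1 - 'X^((m + m) * i + a)) *
                 (1 - 'X^((m + m) * i + (m + m - a)))) =
  \sum_(k < (K + K).+1)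
    qbin ('X^(m + m)) (K + K) k * (-1) ^+ (k + K) *
      'X^(texp m a (k%:Z - K%:Z)) :> {poly int}.
Proof.
move=> am; set t := (m + m)%N.
(* The last K factors contribute degree tK each, the i-th of the first K contributes a + t i. *)
pose e0 := (t * (K * K + 'C(K, 2)) + a * K)%N.
have nz : 'X^e0 * (-1) ^+ K != 0 :> {poly int}.
  by rewrite mulf_neq0 ?signr_eq0 // monic_neq0 ?monicXn.
apply: (mulfI nz).
have C2 k : ('C(k, 2) * 2 = k * k.-1)%N.
  by rewrite muln2 bin2 halfK oddM; case: k => //= k; rewrite andNb subn0.
transitivity (\prod_(i < K + K) ('X^(t * K) - 'X^a * ('X^t) ^+ i) : {poly int});
  last first.
  rewrite qbinomial_theorem mulr_sumr; apply: eq_bigr => k _.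
  rewrite -!exprM -[LHS]mulrA -[LHS]mulrA -[LHS]mulrA -!exprD.
  (* As t = 2m, the binomial coefficients occur doubled, so the exponent is quadratic with integral
     coefficients; centring at j = k - K yields [texp]. *)
  have -> : (t * 'C(k, 2) + (a * k + t * K * (K + K - k)) =
      e0 + texp m a (k%:Z - K%:Z))%N.
    apply/eqP; rewrite -eqz_nat !PoszD texpE //; apply/eqP.
    have kK : (k <= K + K)%N by rewrite -ltnS.
    have /(congr1 Posz) := C2 k; have /(congr1 Posz) := C2 K.
    have pred2 n : (n * n.-1)%:Z = n%:Z * (n%:Z - 1) by case: n => // n; lia.
    rewrite !pred2 /e0 /t !(PoszD, PoszM) -subzn // !PoszD => hK hk.
    move: ('C(k, 2)%:Z) ('C(K, 2)%:Z) (k%:Z) hk hK => ck cK k' hk hK.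
    have -> : (m%:Z + m%:Z) * ck = m%:Z * (ck * 2) by ring.
    rewrite hk.
    have -> : (m%:Z + m%:Z) * (K%:Z * K%:Z + cK) =
      m%:Z * (cK * 2 + K%:Z * K%:Z * 2) by ring.
    by rewrite hK; ring.
  rewrite [(-1) ^+ (k + K)]exprD exprD.
  have sK : (-1) ^+ K * (-1) ^+ K = 1 :> {poly int} by rewrite -expr2 sqrr_sign.
  rewrite -[LHS]mulr1 -[X in _ * X = _]sK; ring.
(* The first half is reversed so that its i-th factor leaves 1 - X^(t i + t - a). *)
rewrite big_split_ord /= [X in _ = X * _](reindex_inj rev_ord_inj) /=.
have -> : \prod_(i < K) ('X^(t * K) - 'X^a * 'X^t ^+ (K - i.+1)) =
   (\prod_(i < K) - 'X^(a + t * (K - i.+1))) *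
   \prod_(i < K) (1 - 'X^(t * i + (t - a))) :> {poly int}.
  rewrite -big_split; apply: eq_bigr => i _ /=.
  rewrite -exprM -exprD mulrBr mulr1 mulNr -exprD opprK addrC; congr (_ + _).
  have h := subnKC (ltn_ord i); have h' := subnK am.
  by congr ('X^_); rewrite -{1}h -/t !mulnDr mulnS; lia.
have -> : \prod_(i < K) ('X^(t * K) - 'X^a * 'X^t ^+ (K + i)) =
   (\prod_(i < K) 'X^(t * K)) *
   \prod_(i < K) (1 - 'X^(t * i + a)) :> {poly int}.
  rewrite -big_split; apply: eq_bigr => i _ /=.
  by rewrite -exprM mulrBr mulr1 -!exprD mulnDr [(a + _)%N]addnC addnA.
rewrite big_split /= prodr_const card_ord -exprM.
have -> : \prod_(i < K) - 'X^(a + t * (K - i.+1)) =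
    (-1) ^+ K * 'X^(a * K + t * 'C(K, 2)) :> {poly int}.
  rewrite (reindex_inj rev_ord_inj) /=.
  have -> : \prod_(i < K) - 'X^(a + t * (K - (K - i.+1).+1)) =
      \prod_(i < K) - 'X^(a + t * i) :> {poly int}.
    by apply: eq_bigr => i _; rewrite subnSK // subKn // ltnW.
  elim: (K) => [|k IH]; first by rewrite big_ord0 !muln0 !expr0 mulr1.
  rewrite big_ord_recr /= IH binS bin1 exprS mulrN mulN1r mulNr -mulrA -exprD.
  by congr (- (_ * 'X^_)); rewrite mulnS mulnDr; lia.
rewrite /e0; have -> : 'X^(t * (K * K + 'C(K, 2)) + a * K) =
    'X^(t * K * K) * 'X^(a * K + t * 'C(K, 2)) :> {poly int}.
  by rewrite -exprD; congr ('X^_); lia.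
ring.
Qed.

Lemma qfact_nilp (R : comNzRingType) (x : R) N t n :
  x ^+ N = 0 -> (0 < t)%N -> (N <= n)%N -> qfact (x ^+ t) n = qfact (x ^+ t) N.
Proof.
move=> xN t0 /subnKC <-.
rewrite /qfact big_split_ord /= [X in _ * X]big1 ?mulr1 //.
move=> i _; rewrite -exprM (nilp_exprn xN) ?subr0 //.
by rewrite -addnS -[N in (N <= _)%N]mul1n leq_mul // leq_addr.
Qed.

Lemma qfact_has_inv (R : comNzRingType) (x : R) N t n :
  x ^+ N = 0 -> (0 < t)%N -> has_inv (qfact (x ^+ t) n).
Proof.
move=> xN t0; apply: has_inv_prod => i; rewrite -exprM.
by apply: nilp_has_invX xN _; rewrite muln_gt0 t0.
Qed.

Definition theta (R : comNzRingType) (x : R) m a M :=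
  \sum_(j <- zrange M) (-1) ^+ absz j * x ^+ texp m a j.

Definition thprod (R : comNzRingType) (x : R) m a K :=
  \prod_(i < K) ((1 - x ^+ ((m + m) * i + a)) *
                 (1 - x ^+ ((m + m) * i + (m + m - a)))).

Lemma rmorph_qbin (R S : comNzRingType) (f : {rmorphism R -> S}) q n k :
  f (qbin q n k) = qbin (f q) n k.
Proof.
elim: n k => [|n IH] [|k] /=; rewrite ?rmorph0 ?rmorph1 //.
by rewrite rmorphD rmorphM rmorphXn /= !IH.
Qed.

(** Image under f of the finite identity with K = 2N. Terms with |j| >= N vanish. Otherwise both
    indices of the Gaussian binomial exceed N, all three q-factorials equal the unit P, and P times
    the binomial is 1. *)
Lemma nilp_jtp (R : comNzRingType) (f : {rmorphism {poly int} -> R}) N m a :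
  f 'X ^+ N = 0 -> (0 < a < m + m)%N ->
  qfact (f 'X ^+ (m + m)) N * thprod (f 'X) m a (N + N) =
  theta (f 'X) m a (N + N).
Proof.
move=> xN /[dup] am /andP[a0 /ltnW am']; set x := f 'X; set P := qfact _ _.
have t0 : (0 < m + m)%N by apply: leq_trans am'.
have := congr1 f (finite_jtp (N + N) am').
rewrite rmorph_prod rmorph_sum /=.
under eq_bigr do rewrite rmorphM !rmorphB !rmorph1 /= !rmorphXn -/x.
rewrite /thprod => ->; rewrite /theta big_map -[X in iota _ X]subn0.
rewrite -/(index_iota _ _) big_mkord mulr_sumr; apply: eq_bigr => k _.
rewrite !rmorphM !rmorphXn /= rmorphN1 rmorph_qbin rmorphXn -/x.
have kK : (k <= N + N + (N + N))%N by rewrite -ltnS.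
have [j_ge|j_lt] := leqP N (absz (k%:Z - (N + N)%:Z)).
  rewrite [x ^+ texp _ _ _](nilp_exprn xN) ?mulr0 //.
  exact: leq_trans j_ge (texp_ge _ am).
have -> : (-1) ^+ absz (k%:Z - (N + N)%:Z) = (-1) ^+ (k + (N + N)) :> R.
  rewrite -signr_odd -[RHS]signr_odd; congr (_ ^+ _); congr nat_of_bool; lia.
rewrite !mulrA; congr (_ * _); rewrite -[RHS]mul1r; congr (_ * _).
have := qbin_qfact (x ^+ (m + m)) k (N + N + (N + N) - k).
rewrite subnKC // !(@qfact_nilp _ x N) //; try lia.
rewrite -/P => E; apply: (has_invI (qfact_has_inv N xN t0)).
by rewrite -/P mulr1 -[RHS]E; ring.
Qed.

(** * Products of two theta series and the three-term relation *)

(* In the notation of the header, [theta2 x 38 a] is Q(a) and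
   [theta2 x 38 (38 + b)] is P(b). *)
Definition theta2 (R : comNzRingType) (x : R) m a M :=
  \sum_(j <- zrange M) x ^+ texp (m + m) (a + a) j.

(** The substitutions (i + j, i - j) for even index sum and (i + j, i - j + 1) for odd index sum
    remove the cross term ij from the exponent, so each half factors. The odd half carries the sign
    -1 and the extra exponent a - b. *)
Lemma theta_pair (R : comNzRingType) (x : R) N m a b M :
    x ^+ N = 0 -> (b < a)%N -> (a <= m)%N -> (N <= M)%N ->
  theta x m (a + b) M * theta x m (a - b) M =
  theta2 x m a M * theta2 x m (m + b) M -
  x ^+ (a - b) * theta2 x m (m + a) M * theta2 x m b M.
Proof.
move=> xN ba am NM.
pose F (p : int * int) := ((-1) ^+ absz p.1 * x ^+ texp m (a + b) p.1) *
   ((-1) ^+ absz p.2 * x ^+ texp m (a - b) p.2).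
pose Z := [seq (i, j) | i <- zrange M, j <- zrange M].
pose ev (p : int * int) := (p.1 + p.2, p.1 - p.2).
pose od (p : int * int) := (p.1 + p.2, p.1 - p.2 + 1).
have uZ : uniq Z.
  by apply: allpairs_uniq => //; [exact: zrange_uniq.. | move=> [? ?] [? ?]].
have mZ p : (p \in Z) = (absz p.1 <= M)%N && (absz p.2 <= M)%N.
  case: p => i j; rewrite -!mem_zrange /=.
  apply/allpairsP/andP => [[p []]|[iM jM]].
    by move=> ? ? [-> ->].
  by exists (i, j).
have -> : theta x m (a + b) M * theta x m (a - b) M = \sum_(p <- Z) F p.
  rewrite /theta mulr_suml big_allpairs; apply: eq_bigr => i _.
  by rewrite mulr_sumr.
(* The square and the union of its two images differ as sets, but both contain every pair with a
   nonzero term, since such a pair has |i|, |j| < N. *)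
have -> : \sum_(p <- Z) F p = \sum_(p <- map ev Z ++ map od Z) F p.
  apply: eq_big_seq_supp => //.
    rewrite cat_uniq; apply/and3P; split.
    - by rewrite map_inj_uniq // => -[i j] [i' j'] [] ? ?; congr pair; lia.
    - apply/hasPn => _ /mapP[[i j] _ ->]; apply/mapP => -[[i' j'] _ []]; lia.
    - by rewrite map_inj_uniq // => -[i j] [i' j'] [] ? ?; congr pair; lia.
  move=> [i j] nz.
  have lt a' k : (0 < a' < m + m)%N -> x ^+ texp m a' k != 0 -> (absz k < N)%N.
    move=> a'm; apply: contraNT; rewrite -leqNgt => Nk; apply/eqP.
    exact: nilp_exprn xN (leq_trans Nk (texp_ge _ a'm)).
  have iN : (absz i < N)%N.
    apply: (lt (a + b)%N i); first lia.
    by apply: contraNneq nz; rewrite /F /= => ->; rewrite mulr0 mul0r.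
  have jN : (absz j < N)%N.
    apply: (lt (a - b)%N j); first lia.
    by apply: contraNneq nz; rewrite /F /= => ->; rewrite !mulr0.
  rewrite mZ mem_cat; apply/andP; split; first by rewrite /=; lia.
  apply/orP.
  have [o|e] := boolP (odd (absz (i + j))).
    right; apply/mapP; exists (((i + j - 1) %/ 2)%Z, ((i - j + 1) %/ 2)%Z).
      by rewrite mZ /=; lia.
    by rewrite /od /=; congr pair; lia.
  left; apply/mapP; exists (((i + j) %/ 2)%Z, ((i - j) %/ 2)%Z).
    by rewrite mZ /=; lia.
  by rewrite /ev /=; congr pair; lia.
rewrite big_cat !big_map !big_allpairs /=; congr (_ + _).
  rewrite /theta2 mulr_suml; apply: eq_bigr => i _.
  rewrite mulr_sumr; apply: eq_bigr => j _.
  rewrite /F /= mulrACA -!exprD -signr_odd.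
  have -> : odd (absz (i + j) + absz (i - j)) = false by lia.
  rewrite mul1r; congr (x ^+ _); apply/eqP; rewrite -eqz_nat !PoszD !texpE; lia.
rewrite -mulNr -mulNr /theta2 [X in _ = X * _]mulr_sumr mulr_suml.
apply: eq_bigr => i _.
rewrite mulr_sumr; apply: eq_bigr => j _.
rewrite /F /= mulrACA -!exprD -signr_odd.
have -> : odd (absz (i + j) + absz (i - j + 1)) = true by lia.
rewrite mulN1r !mulNr -!exprD; congr (- x ^+ _).
apply/eqP; rewrite -eqz_nat !PoszD !texpE; lia.
Qed.

(** Up to a power of x, the paired products are the 2 by 2 minors of the vectors (Q(r), x^r P(r))
    for r = a, b, c, d; balancing these powers in the Pluecker relation leaves x^(b - c). *)
Lemma three_term_thprod (R : comNzRingType) (f : {rmorphism {poly int} -> R})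
    N m a b c d :
    f 'X ^+ N = 0 -> (d < c)%N -> (c < b)%N -> (b < a)%N -> (a <= m)%N ->
  let T r := thprod (f 'X) m r (N + N) in
  f 'X ^+ (b - c) * (T (a + b)%N * T (a - b)%N * (T (c + d)%N * T (c - d)%N)) +
    T (a + d)%N * T (a - d)%N * (T (b + c)%N * T (b - c)%N) =
  T (a + c)%N * T (a - c)%N * (T (b + d)%N * T (b - d)%N).
Proof.
move=> xN dc cb ba am T; set x := f 'X in T xN *.
have t0 : (0 < m + m)%N by lia.
(* Each term has four factors [T], and each takes one P to become a theta series. *)
have iP := has_invX 4 (qfact_has_inv N xN t0); set P := qfact _ _ in iP.
have PT r s : (s < r)%N -> (r <= m)%N -> P * T (r + s)%N * (P * T (r - s)%N) =
    theta2 x m r (N + N) * theta2 x m (m + s) (N + N) -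
    x ^+ (r - s) * theta2 x m (m + r) (N + N) * theta2 x m s (N + N).
  move=> sr rm; rewrite /P /T !nilp_jtp //; try lia.
  by rewrite (theta_pair xN) // leq_addr.
have ab := PT a b ltac:(lia) ltac:(lia).
have ac := PT a c ltac:(lia) ltac:(lia).
have ad := PT a d ltac:(lia) ltac:(lia).
have bc := PT b c ltac:(lia) ltac:(lia).
have bd := PT b d ltac:(lia) ltac:(lia).
have cd := PT c d ltac:(lia) ltac:(lia).
apply: (has_invI iP); rewrite mulrDr.
have -> p q r s : P ^+ 4 * (p * q * (r * s)) =
  P * p * (P * q) * (P * r * (P * s)) by ring.
have -> p q r s : P ^+ 4 * (p * q * (r * s)) =
  P * p * (P * q) * (P * r * (P * s)) by ring.
have -> y p q r s : P ^+ 4 * (y * (p * q * (r * s))) =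
  y * (P * p * (P * q) * (P * r * (P * s))) by ring.
rewrite ab ac ad bc bd cd.
(* In terms of the three consecutive gaps the relation is a polynomial identity. *)
have -> : (a - c = a - b + (b - c))%N by lia.
have -> : (b - d = b - c + (c - d))%N by lia.
have -> : (a - d = a - b + (b - c) + (c - d))%N by lia.
rewrite !exprD; ring.
Qed.

(** * Generating functions of colored partitions *)

(** Starting at i = 0 makes the range split into whole residue blocks. The factor at 0 is 0^(c 0),
    which is 1 when c 0 = 0. *)
Definition parts_prod (R : comNzRingType) (x : R) (c : nat -> nat) L :=
  \prod_(i < L) (1 - x ^+ i) ^+ c i.

Definition parts_gf (c : nat -> nat) n : {poly int} :=
  \prod_(i < n) (\sum_(k < n.+1) 'X^(i.+1) ^+ k) ^+ c i.+1.

(** Expanding the product chooses a multiplicity for each colored part, so the monomials are indexed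
    by the very functions being counted. *)
Lemma coef_parts_gf c n : (parts_gf c n)`_n = (num_colored_partitions c n)%:Z.
Proof.
have -> : parts_gf c n = \sum_(g : {ffun colored_part c n -> 'I_n.+1})
    'X^(\sum_p g p * part_size p).
  transitivity (\prod_(p : colored_part c n)
      \sum_(k < n.+1) 'X^(k * part_size p) : {poly int}).
    rewrite /parts_gf.
    under [LHS]eq_bigr => i _ do rewrite -[c i.+1]card_ord -prodr_const.
    rewrite sig_big_dep; apply: eq_big => [p|p _]; first by rewrite inE.
    by apply: eq_bigr => k _; rewrite -exprM mulnC.
  rewrite bigA_distr_bigA; apply: eq_bigr => g _.
  by rewrite -(big_morph _ (@exprD _ 'X) (expr0 'X)).
rewrite coef_sum /num_colored_partitions -sum1_card.
under [LHS]eq_bigr do rewrite coefXn.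
rewrite -natz natr_sum [RHS]big_mkcond; apply: eq_bigr => g _.
by rewrite inE eq_sym; case: eqP.
Qed.

Lemma parts_prod_nilp (R : comNzRingType) (x : R) c n L : x ^+ n = 0 ->
  (n <= L)%N -> parts_prod x c L = parts_prod x c n.
Proof.
move=> xn /subnKC <-.
rewrite /parts_prod big_split_ord /= [X in _ * X]big1 ?mulr1 //.
by move=> i _; rewrite (nilp_exprn xn) ?leq_addr // subr0 expr1n.
Qed.

Lemma parts_gf_inv (R : comNzRingType) (f : {rmorphism {poly int} -> R}) c n :
  f 'X ^+ n.+1 = 0 -> c 0 = 0%N ->
  f (parts_gf c n) * parts_prod (f 'X) c n.+1 = 1.
Proof.
move=> xn c0.
rewrite /parts_prod big_ord_recl c0 expr0 mul1r rmorph_prod -big_split.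
apply: big1 => i _ /=; rewrite rmorphXn -exprMn.
have -> : f (\sum_(k < n.+1) 'X^(i.+1) ^+ k) * (1 - f 'X ^+ bump 0 i) = 1.
  rewrite mulrC -opprB mulNr rmorph_sum /bump /= add1n.
  under eq_bigr do rewrite !rmorphXn /=.
  by rewrite -subrX1 -exprM mulnC exprM xn expr0n sub0r opprK.
by rewrite expr1n.
Qed.

Lemma in_qpolyX_nilp N : in_qpoly ('X^(N.+1)) ('X : {poly int}) ^+ N.+1 = 0.
Proof.
rewrite -rmorphXn; apply/val_inj.
by rewrite /= mk_monic_Xn Pdiv.RingMonic.rmodpp ?monicXn.
Qed.

Lemma in_qpolyXn_eq N (p q : {poly int}) :
  (in_qpoly ('X^(N.+1)) p = in_qpoly ('X^(N.+1)) q) <->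
  (forall i, (i <= N)%N -> p`_i = q`_i).
Proof.
have take (r : {poly int}) :
    in_qpoly ('X^(N.+1)) r = in_qpoly ('X^(N.+1)) (take_poly N.+1 r).
  rewrite -[r in LHS](poly_take_drop N.+1) rmorphD rmorphM rmorphXn /=.
  by rewrite in_qpolyX_nilp mulr0 addr0.
rewrite [in_qpoly _ p]take [in_qpoly _ q]take.
split => [/(congr1 (@polyn _ _))|pq].
  rewrite !in_qpoly_small ?mk_monic_Xn ?size_polyXn ?ltnS ?size_take_poly //.
  by move=> /polyP pq i iN; have := pq i; rewrite !coef_take_poly ltnS iN.
congr in_qpoly; apply/polyP => i; rewrite !coef_take_poly ltnS.
by case: ifP => // /pq.
Qed.

(** Lets all counts be read off at one level N. Modulo X^(n+1) both polynomials are inverse to the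
    same product, hence equal. *)
Lemma coef_parts_gf_le c n N : c 0 = 0%N -> (n <= N)%N ->
  (parts_gf c N)`_n = (num_colored_partitions c n)%:Z.
Proof.
move=> c0 nN; rewrite -coef_parts_gf.
suff /in_qpolyXn_eq/(_ n (leqnn n)) : in_qpoly ('X^(n.+1)) (parts_gf c N) =
  in_qpoly ('X^(n.+1)) (parts_gf c n) by [].
have xn := in_qpolyX_nilp n.
have gn := parts_gf_inv xn c0.
have := parts_gf_inv (nilp_exprn xn (nN : n < N.+1)%N) c0.
rewrite (parts_prod_nilp c xn) // => gN.
by rewrite -[LHS]mulr1 -gn mulrCA gN mulr1.
Qed.

(** * From color counts to the theta relation *)

Lemma thprodC (R : comNzRingType) (x : R) m a K :
  (a <= m + m)%N -> thprod x m (m + m - a) K = thprod x m a K.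
Proof. by move=> am; apply: eq_bigr => i _; rewrite subKn // mulrC. Qed.

(** Each block of t = 2m consecutive indices meets the residues a and t - a once. If a = m they
    coincide, and both sides have the squared factor. *)
Lemma thprod_pm (R : comNzRingType) (x : R) m a K :
  (0 < a < m + m)%N ->
  parts_prod x (pm a (m + m)) ((m + m) * K) = thprod x m a K.
Proof.
move=> /andP[a0]; set t := (m + m)%N => am; rewrite /thprod /parts_prod -/t.
elim: K => [|K IH]; first by rewrite muln0 !big_ord0.
rewrite mulnS addnC big_split_ord IH big_ord_recr /=; congr (_ * _).
have E (r : 'I_t) :
    pm a t (t * K + r) = ((r == a :> nat) + (r == t - a :> nat)%N)%N.
  have rt := ltn_ord r.
  rewrite /pm mulnC -addnA !modnMDl mod0n; congr (_ + _)%N.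
    by rewrite !modn_small.
  congr nat_of_bool; apply/idP/eqP => [/eqP|->]; last first.
    by rewrite subnK ?modnn // ltnW.
  have [ra|ra] := ltnP (r + a) t; first by rewrite modn_small //; lia.
  by rewrite -(subnK ra) modnDr modn_small; lia.
under eq_bigr => i _ do rewrite E exprD.
have pick s : (s < t)%N ->
    \prod_(i < t) (1 - x ^+ (t * K + i)) ^+ (i == s :> nat) =
    1 - x ^+ (t * K + s).
  move=> st; rewrite (bigD1 (Ordinal st)) //= eqxx expr1 big1 ?mulr1 // => i.
  by rewrite -val_eqE /= => /negPf ->.
by rewrite big_split /= !pick // ltn_subrL a0 (ltn_trans a0).
Qed.

Lemma parts_prodD (R : comNzRingType) (x : R) c d L :
  parts_prod x (fun k => c k + d k)%N L = parts_prod x c L * parts_prod x d L.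
Proof. by rewrite -big_split; apply: eq_bigr => i _; rewrite exprD. Qed.

Lemma parts_prodM (R : comNzRingType) (x : R) c d L :
  parts_prod x (fun k => d * c k)%N L = parts_prod x c L ^+ d.
Proof. by rewrite -prodrXl; apply: eq_bigr => i _; rewrite mulnC exprM. Qed.

Lemma parts_gf_three_term n i : (i <= n)%N ->
  (parts_gf colors1 n + parts_gf colors2 n * 'X^18)`_i =
  (parts_gf colors3 n)`_i.
Proof.
move: i; apply/in_qpolyXn_eq.
set x := in_qpoly ('X^(n.+1)) ('X : {poly int}).
have xn : x ^+ n.+1 = 0 := in_qpolyX_nilp n.
pose L := (76 * (n.+1 + n.+1))%N.
pose T r := thprod x 38 r (n.+1 + n.+1).
have TE r : (0 < r < 76)%N -> parts_prod x (pm r 76) L = T r :=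
  thprod_pm x (m := 38) _.
have E1 : parts_prod x colors1 L = T 1%N ^+ 2 * T 19%N ^+ 2 * T 36%N * T 38%N.
  by rewrite -!TE // -!parts_prodM -!parts_prodD.
have E2 : parts_prod x colors2 L = T 19%N ^+ 2 * T 36%N * T 37%N ^+ 2 * T 38%N.
  by rewrite -!TE // -!parts_prodM -!parts_prodD.
have E3 : parts_prod x colors3 L = T 1%N ^+ 2 * T 18%N * T 20%N * T 37%N ^+ 2.
  by rewrite -!TE // -!parts_prodM -!parts_prodD.
have G c : c 0 = 0%N ->
    in_qpoly ('X^(n.+1)) (parts_gf c n) * parts_prod x c L = 1.
  by move=> c0; rewrite (parts_prod_nilp c xn) ?(parts_gf_inv xn) // /L; lia.
(* 56 = 37 + 19 is the only index of the relation that leaves the range up to 38; 76 - 56 = 20. *)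
have T56 : T 56%N = T 20%N := thprodC x _ (m := 38) (a := 20) erefl.
have W a b c d : (d < c)%N -> (c < b)%N -> (b < a)%N -> (a <= 38)%N ->
  x ^+ (b - c) * (T (a + b)%N * T (a - b)%N * (T (c + d)%N * T (c - d)%N)) +
    T (a + d)%N * T (a - d)%N * (T (b + c)%N * T (b - c)%N) =
  T (a + c)%N * T (a - c)%N * (T (b + d)%N * T (b - d)%N).
  exact: three_term_thprod.
have {}W : x ^+ 18 * (T 20%N * T 18%N * (T 1%N * T 1%N)) +
    T 37%N * T 37%N * (T 20%N * T 18%N) =
    T 38%N * T 36%N * (T 19%N * T 19%N).
  by rewrite -{1}T56; clearbody T; exact: (W 37 19 1 0).
have := G colors3 erefl; have := G colors2 erefl; have := G colors1 erefl.
rewrite rmorphD rmorphM rmorphXn /= -/x.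
move: (in_qpoly _ _) (in_qpoly _ _) (in_qpoly _ _) => h3 h2 h1 G1 G2 G3.
move: (parts_prod x colors1 L) (parts_prod x colors2 L) (parts_prod x colors3 L)
  E1 E2 E3 G1 G2 G3 => e1 e2 e3 E1 E2 E3 G1 G2 G3.
clearbody T.
(* Denominators are cleared by inserting factors h e = 1, which gives every term the common factor
   h1 h2 h3. *)
transitivity (h1 * (h2 * e2) * (h3 * e3) +
    h2 * (h1 * e1) * (h3 * e3) * x ^+ 18).
  by rewrite G1 G2 G3 !mulr1.
transitivity (h3 * (h1 * e1) * (h2 * e2)); last by rewrite G1 G2 !mulr1.
(* The factor (T1 T19 T37)^2 T36 T38 is common to e2 e3, e1 e3 and e1 e2; what remains is the
   relation [W]. *)
transitivity (h1 * h2 * h3 *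
    ((T 1%N * T 19%N * T 37%N) ^+ 2 * T 36%N * T 38%N) *
    (x ^+ 18 * (T 20%N * T 18%N * (T 1%N * T 1%N)) +
     T 37%N * T 37%N * (T 20%N * T 18%N))).
  by rewrite E1 E2 E3; ring.
by rewrite W E1 E2; ring.
Qed.

End ThetaProducts.

Theorem theorem5p2 (n : nat) (hn : 18 <= n) :
  F1 n + F2 (n - 18) = F3 n.
Proof.
have := parts_gf_three_term (leqnn n).
rewrite coefD coefMXn ltnNge hn /= !coef_parts_gf_le ?leq_subr //.
by rewrite -PoszD => -[].
Qed.
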